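(* Let $X$ be a nonempty set. If $k$ is an infinite field, then $Y=T^{(2)}+\{x^{\mathrm{char}(k)}\}^S$ (where $x\in X$) is a maximum proper $T$-space of $k\langle X\rangle$; that is, $Y$ is a proper $T$-space of $k\langle X\rangle$ and every proper $T$-space of $k\langle X\rangle$ is contained in $Y$.
   Context: $k\langle X\rangle$ denotes the free unitary associative $k$-algebra on $X$. A $T$-space of $k\langle X\rangle$ is a $k$-linear subspace invariant under every (unitary) $k$-algebra endomorphism of $k\langle X\rangle$; a $T$-ideal is a $T$-space that is also a two-sided ideal. For $H\subseteq k\langle X\rangle$, $H^S$ denotes the smallest $T$-space of $k\langle X\rangle$ containing $H$. $T^{(2)}$ is the $T$-ideal of $k\langle X\rangle$ generated by the commutator $[x,y]=xy-yx$ of two distinct elements $x,y\in X$ (and $T^{(2)}=\{0\}$ if $|X|=1$). When $\mathrm{char}(k)=0$, $x^{\mathrm{char}(k)}=x^0$ is interpreted as $1$. *)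

(* Defs.v *)
From HB Require Import structures.
From mathcomp Require Import all_boot all_algebra.
From mathcomp Require Import boolp classical_sets cardinality.
From mathcomp Require Import monalg.

Set Implicit Arguments.
Unset Strict Implicit.
Unset Printing Implicit Defensive.

Import GRing.Theory.

Local Open Scope classical_set_scope.
Local Open Scope ring_scope.

(* The characteristic as a number: [pchar k] contains at most one prime, and
   xget returns the default 0 when it contains none. *)
Definition fchar (k : fieldType) : nat := xget 0%N [set p | p \in [pchar k]].

(* k<X>: the monoid algebra over k of the free monoid on X. *)
Definition free_alg (k : fieldType) (X : choiceType) : lalgType k :=
  {malg k[{fmonom X}]}.

Section TSpaces.
Variables (k : fieldType) (X : choiceType).
Local Notation A := (free_alg k X).
Implicit Types V W : set A.

Definition gen (x : X) : A := (<< fmu x >> : {malg k[{fmonom X}]}).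

Definition subspace V : Prop :=
  V 0 /\ forall (a : k) (u v : A), V u -> V v -> V (a *: u + v).

Definition tspace V : Prop :=
  subspace V /\ forall (phi : {lrmorphism A -> A}) (u : A), V u -> V (phi u).

Definition tideal V : Prop :=
  tspace V /\ forall u v : A, V v -> V (u * v) /\ V (v * u).

Definition tspace_gen (H : set A) : set A := smallest tspace H.

(* Taking all pairs of distinct variables at once gives the T-ideal generated
   by any single such commutator, since endomorphisms may rename variables,
   and gives {0} when X has only one element. *)
Definition T2 : set A :=
  smallest tideal
    [set c | exists x y : X, x != y /\ c = gen x * gen y - gen y * gen x].

Definition add_set V W : set A := [set u + v | u in V & v in W].

Definition proper_tspace V : Prop := tspace V /\ V <> setT.

Definition maximum_proper_tspace V : Prop :=
  proper_tspace V /\ forall W, proper_tspace W -> W `<=` V.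

End TSpaces.

Arguments gen k {X} x.
Arguments T2 k X : clear implicits.

(* Main.v *)
Require Import Defs.
From HB Require Import structures.
From mathcomp Require Import all_boot all_algebra.
From mathcomp Require Import boolp classical_sets cardinality.
From mathcomp Require Import finmap monalg.

(**
The argument has two independent halves.  Write p for the characteristic
[fchar k], which is prime or 0; an integer n vanishes in k exactly when p
divides n ([fchar_dvd]).

Y is proper because the derivative detects it.  Under any algebra morphism
from k<X> to k[t] the commutators vanish, and a p-th power becomes a p-th
power, whose derivative is 0 (for p = 0 it is the constant 1).  The elements
whose images in k[t] always have zero derivative form a T-space
([critical_tspace]) which contains Y, but not a variable, since a variable
can be sent to t.

For maximality let W be a proper T-space.  As k is infinite, rescaling one
variable by all scalars and inverting a Vandermonde matrix shows that W
contains the homogeneous components of its elements ([tspace_component]), so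
it is enough to treat a multihomogeneous f in W ([multihomogeneous_sub]).
The words of such an f are rearrangements of a single word s, and words that
are rearrangements of one another agree modulo T2 ([T2_perm]), so f is
congruent to C s, where C is the sum of the coefficients of f.
- If C = 0, then f is in T2.
- If every variable occurs in s a number of times divisible by p, then s is a
  rearrangement of a p-th power, and f is in Y.
- Otherwise C is nonzero and some variable y has a degree d in s with d
  nonzero in k.  Sending y to 1 + a u and all other variables to 1 turns f
  into C (1 + a u)^d; the coefficient C d u of a then lies in W, for every u,
  and W is the whole algebra ([tspace_full]).  This is excluded.
*)

Set Implicit Arguments.
Unset Strict Implicit.
Unset Printing Implicit Defensive.

Import GRing.Theory.

Local Open Scope classical_set_scope.
Local Open Scope ring_scope.

(** * Arithmetic, lists and Vandermonde matrices *)

Section Preliminaries.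

(** The step that moves the letter a to the front of a word c a d, at the cost
    of a multiple of a commutator. *)
Lemma swap_letter (R : pzRingType) (a b c d : R) :
  a * b - c * (a * d) = a * (b - c * d) + (a * c - c * a) * d.
Proof. by rewrite mulrBl mulrBr !mulrA addrA subrK. Qed.

Lemma commutator_product (R : pzRingType) (a b c : R) :
  a * (b * c) - b * c * a = (a * b - b * a) * c + b * (a * c - c * a).
Proof. by rewrite mulrBl mulrBr !mulrA addrA subrK. Qed.

Lemma fchar_dvd (k : fieldType) (n : nat) :
  (fchar k %| n)%N = (n%:R == 0 :> k).
Proof.
rewrite /fchar; case: xgetP => [p -> /= /dvdn_pcharf ->|no_char] //.
have /pcharf0P -> : [pchar k] =i pred0.
  by move=> p; apply/negbTE/negP; exact: no_char.
by rewrite dvd0n.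
Qed.

(** For p = 0 divisibility says that s is empty, and the 0-th power of any word
    is empty as well. *)
Lemma perm_flatten_nseq (X : eqType) (p : nat) (s : seq X) :
  (forall x, (p %| count_mem x s)%N) ->
  exists w, perm_eq s (flatten (nseq p w)).
Proof.
move=> p_dvd.
(* w keeps each letter with 1/p of its multiplicity in s *)
exists (flatten [seq nseq (count_mem y s %/ p) y | y <- undup s]).
apply/allP => x _; apply/eqP.
rewrite [RHS]count_flatten map_nseq sumn_nseq count_flatten -map_comp sumnE.
rewrite big_map /= -[LHS](divnK (p_dvd x)); congr (_ * _)%N.
under eq_bigr => y _ do rewrite count_nseq /=.
have [xs|xNs] := boolP (x \in s).
  rewrite (bigD1_seq x) ?undup_uniq ?mem_undup //= eqxx mul1n.
  by rewrite big1 ?addn0 // => y /negbTE ->.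
rewrite (count_memPn xNs) div0n big1_seq // => y /andP[_].
rewrite mem_undup => ys; case: eqP => [yx|//].
by rewrite -yx ys in xNs.
Qed.

Lemma Vandermonde_unit (F : fieldType) n (a : 'rV[F]_n) :
  injective (a 0) -> Vandermonde n a \in unitmx.
Proof.
move=> a_inj; rewrite unitmxE det_Vandermonde unitfE.
apply/prodf_neq0 => i _; apply/prodf_neq0 => j ij.
by rewrite subr_eq0; apply: contraTneq ij => /a_inj ->; rewrite ltnn.
Qed.

Lemma infinite_distinct (T : choiceType) n :
  infinite_set [set: T] -> exists a : 'I_n -> T, injective a.
Proof.
move=> /(@infinite_set_fset _ _ n)[B _ nB].
(* a default element for nth exists as soon as there is an index to use it *)
have x0 : 'I_n -> T by case: n nB => [|n] nB [] // i _; case: B nB => -[].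
exists (fun i => nth (x0 i) B i) => i j.
rewrite (set_nth_default (x0 j)) ?(leq_trans (ltn_ord i)) //.
move/eqP; rewrite nth_uniq ?fset_uniq ?(leq_trans (ltn_ord _) nB) //.
by move/eqP/val_inj.
Qed.

End Preliminaries.

(** * Words and substitutions *)

Section FreeAlgebra.
Variables (k : fieldType) (X : choiceType).
Local Notation A := (free_alg k X).

Definition word (s : seq X) : A := \prod_(x <- s) gen k x.

Lemma word_cat s t : word (s ++ t) = word s * word t.
Proof. exact: big_cat. Qed.

Lemma word_cons x s : word (x :: s) = gen k x * word s.
Proof. exact: big_cons. Qed.

Lemma monomial_word (s : seq X) :
  (<< FMonom s >> : {malg k[{fmonom X}]}) = word s.
Proof.
elim: s => [|x s IHs].
  by rewrite /word big_nil -fmoneE.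
rewrite word_cons -IHs /gen.
apply: etrans (_ : (<< fmu x >> : {malg k[{fmonom X}]}) * << FMonom s >> = _);
  last by [].
rewrite malgM_def fgmulUU mulr1; congr (<< _ >>).
by apply/val_inj; rewrite /= fmM fmU.
Qed.

(** Indexing by a list r of words with an external coefficient function c,
    rather than by the support of f, makes passing to a homogeneous component
    a mere filtering of r. *)
Lemma sum_of_words (f : A) :
  exists (r : seq (seq X)) (c : seq X -> k), f = \sum_(s <- r) c s *: word s.
Proof.
exists [seq @fmonom_val X m | m <- msupp (f : {malg k[{fmonom X}]})].
exists (fun s => (f : {malg k[{fmonom X}]})@_(FMonom s)).
rewrite big_map [LHS]monalgE; apply: eq_bigr => -[s] _ /=.
rewrite -monomial_word.
apply/malgP=> m; rewrite [RHS]mcoeffZ !mcoeffU.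
by case: eqP => _; rewrite ?mulr1 ?mulr0.
Qed.

(** A left algebra only gives c (u v) = (c u) v.  Centrality of the scalars is
    what makes substitutions multiplicative. *)
Lemma free_alg_central (c : k) (u v : A) : u * (c *: v) = c *: (u * v).
Proof.
have Cc (w : A) : w * (malgC c : {malg k[{fmonom X}]}) = c *: w.
  rewrite [LHS]malgM_def fgmulgU.
  rewrite [RHS]malgZ_def; apply: eq_bigr => m _.
  by rewrite mulm1 mulrC.
have cC (w : A) : (malgC c : {malg k[{fmonom X}]}) * w = c *: w.
  exact: mul_malgC.
by rewrite -cC mulrA Cc scalerAl.
Qed.

(** The universal property of k<X>.  It is stated for left algebras with
    central scalars so that k<X> itself is an allowed target. *)
Lemma free_alg_hom (B : lalgType k)
    (B_central : forall c (u v : B), u * (c *: v) = c *: (u * v)) (g : X -> B) :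
  exists phi : {lrmorphism A -> B}, forall x, phi (gen k x) = g x.
Proof.
pose h (m : {fmonom X}) := \prod_(x <- m) g x.
have h_mor : mmorphism h.
  split=> [m n|]; last by rewrite /h fm1 big_nil.
  by rewrite /h fmM big_cat.
pose h' : {mmorphism {fmonom X} -> B} :=
  HB.pack h (isMultiplicative.Build _ _ _ h_mor).
pose psi : A -> B := mmap (in_alg B) h'.
have psi_zmod : zmod_morphism psi by move=> u v; exact: mmapB.
have psi_monoid : monoid_morphism psi.
  split; first exact: mmap1.
  move=> u v; apply: (commr_mmap_is_multiplicative _).1 => f m m'.
  by rewrite /GRing.comm /= mulr_algl B_central mulr1.
have psi_scale : scalable psi.
  by move=> c u; rewrite [LHS]mmapZ /= mulr_algl.
pose phi : {lrmorphism A -> B} := HB.pack psi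
  (GRing.isZmodMorphism.Build _ _ _ psi_zmod)
  (GRing.isMonoidMorphism.Build _ _ _ psi_monoid)
  (GRing.isScalable.Build _ _ _ _ _ psi_scale).
exists phi => x; rewrite /= /psi mmapU /= scale1r mul1r.
by rewrite /h fmU big_seq1.
Qed.

Lemma hom_word (B : lalgType k) (phi : {lrmorphism A -> B}) (s : seq X) :
  phi (word s) = \prod_(x <- s) phi (gen k x).
Proof. exact: rmorph_prod. Qed.

Lemma exprZ_free_alg (c : k) (u : A) n : (c *: u) ^+ n = c ^+ n *: u ^+ n.
Proof.
elim: n => [|n IHn]; first by rewrite !expr0 scale1r.
by rewrite !exprS IHn -scalerAl (free_alg_central (c ^+ n)) scalerA.
Qed.

Lemma scaling_word (phi : {lrmorphism A -> A}) (x : X) (c : k) (s : seq X) :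
  (forall y, phi (gen k y) = (if y == x then c else 1) *: gen k y) ->
  phi (word s) = c ^+ count_mem x s *: word s.
Proof.
move=> phiE; rewrite hom_word; elim: s => [|y s IHs].
  by rewrite /word !big_nil expr0 scale1r.
rewrite big_cons IHs phiE -scalerAl (free_alg_central (c ^+ _)) -word_cons.
rewrite scalerA /=; case: eqP => _; first by rewrite add1n exprS.
by rewrite add0n mul1r.
Qed.

(** * Subspaces and T-spaces *)

Section Subspace.
Variable V : set A.
Hypothesis V_sub : subspace V.

Lemma subspaceD u v : V u -> V v -> V (u + v).
Proof. by move=> Vu Vv; rewrite -[u]scale1r; exact: V_sub.2. Qed.

Lemma subspaceZ c u : V u -> V (c *: u).
Proof. by move=> Vu; rewrite -[_ *: _]addr0; apply: V_sub.2 => //; exact: V_sub.1. Qed.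

Lemma subspace_sum (I : eqType) (r : seq I) (F : I -> A) :
  {in r, forall i, V (F i)} -> V (\sum_(i <- r) F i).
Proof.
move=> VF; rewrite big_seq; apply: big_ind => [||i ir]; last exact: VF.
- exact: V_sub.1.
- exact: subspaceD.
Qed.

(** Evaluating at n distinct scalars expresses each coefficient as a linear
    combination of values, by the inverse of a Vandermonde matrix. *)
Lemma subspace_coef (k_infinite : infinite_set [set: k]) n (e : nat -> A) :
  (forall c : k, V (\sum_(i < n) c ^+ i *: e i)) ->
  forall i, (i < n)%N -> V (e i).
Proof.
move=> Ve i ltin; have [a a_inj] := infinite_distinct n k_infinite.
pose M := Vandermonde n (\row_j a j).
have M_unit : M \in unitmx.
  by apply: Vandermonde_unit => j1 j2; rewrite !mxE; exact: a_inj.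
pose i0 := Ordinal ltin.
suff -> : e i = \sum_j invmx M j i0 *: \sum_(l < n) a j ^+ l *: e l.
  by apply: subspace_sum => j _; exact: subspaceZ.
under eq_bigr => j _ do rewrite scaler_sumr.
rewrite exchange_big /=.
under eq_bigr => l _.
  under eq_bigr => j _ do rewrite scalerA mulrC.
  rewrite -scaler_suml (_ : \sum_j _ = (M *m invmx M) l i0); last first.
    by rewrite mxE; apply: eq_bigr => j _; rewrite !mxE.
  rewrite mulmxV // mxE.
  over.
rewrite (bigD1 i0) //= eqxx scale1r big1 ?addr0 // => l /negbTE ->.
exact: scale0r.
Qed.

End Subspace.

Lemma add_tspace (V W : set A) : tspace V -> tspace W -> tspace (add_set V W).
Proof.
move=> [V_sub V_hom] [W_sub W_hom]; split; first split.
- exists 0; first exact: V_sub.1.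
  by exists 0; rewrite ?addr0 //; exact: W_sub.1.
- move=> c _ _ [u1 Vu1 [u2 Wu2 <-]] [v1 Vv1 [v2 Wv2 <-]].
  exists (c *: u1 + v1); first exact: V_sub.2.
  exists (c *: u2 + v2); first exact: W_sub.2.
  by rewrite scalerDr addrACA.
move=> phi _ [u Vu [v Wv <-]].
exists (phi u); first exact: V_hom.
by exists (phi v); [exact: W_hom | rewrite raddfD].
Qed.

Lemma tspace_gen_tspace (H : set A) : tspace (tspace_gen H).
Proof.
split; first split.
- by move=> V [[[V0 _] _] _].
- move=> c u v Vu Vv V VH; have [[[_ V_lin] _] _] := VH.
  by apply: V_lin; [exact: Vu | exact: Vv].
by move=> phi u Vu V VH; have [[_ V_hom] _] := VH; apply: V_hom; exact: Vu.
Qed.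

Lemma word_power (x : X) (w : seq X) (n : nat) :
  tspace_gen [set gen k x ^+ n] (word (flatten (nseq n w))).
Proof.
have [phi phiE] := free_alg_hom free_alg_central (fun=> word w).
rewrite (_ : word _ = phi (gen k x ^+ n)).
  by apply: (tspace_gen_tspace _).2; exact: sub_gen_smallest.
rewrite [RHS]rmorphXn /= phiE; elim: n => [|n IHn] /=.
  by rewrite /word big_nil expr0.
by rewrite word_cat IHn exprS.
Qed.

Lemma T2_tideal : tideal (T2 k X).
Proof.
split; first split; first split.
- by move=> V [[[[V0 _] _] _] _].
- move=> c u v Vu Vv V VH; have [[[[_ V_lin] _] _] _] := VH.
  by apply: V_lin; [exact: Vu | exact: Vv].
- move=> phi u Vu V VH; have [[[_ V_hom] _] _] := VH.
  by apply: V_hom; exact: Vu.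
move=> u v Vv; split=> V VH; have [[_ V_mul] _] := VH.
  by have [] := V_mul u v (Vv V VH).
by have [] := V_mul u v (Vv V VH).
Qed.

(** * Words modulo T2 *)

Let T2_sub : subspace (T2 k X) := T2_tideal.1.1.

(** [T2] is generated by the commutators of distinct variables; the case x = y
    spares later arguments the distinction. *)
Lemma T2_gen_comm x y : T2 k X (gen k x * gen k y - gen k y * gen k x).
Proof.
have [->|xy] := eqVneq x y; first by rewrite subrr; exact: T2_sub.1.
by apply: sub_gen_smallest; exists x, y.
Qed.

Lemma T2_word_comm x s : T2 k X (gen k x * word s - word s * gen k x).
Proof.
elim: s => [|y s IHs].
  by rewrite /word big_nil mulr1 mul1r subrr; exact: T2_sub.1.
rewrite word_cons (_ : _ - _ = (gen k x * gen k y - gen k y * gen k x) * word s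
   + gen k y * (gen k x * word s - word s * gen k x)).
  apply: (subspaceD T2_sub); first exact: (T2_tideal.2 _ _ (T2_gen_comm x y)).2.
  exact: (T2_tideal.2 _ _ IHs).1.
exact: commutator_product.
Qed.

(** Commuting the first letter of s through the prefix of t that precedes its
    first occurrence there reduces the claim to shorter words. *)
Lemma T2_perm s t : perm_eq s t -> T2 k X (word s - word t).
Proof.
elim: s t => [|x s IHs] t st.
  move: st; rewrite perm_sym => /perm_nilP ->.
  by rewrite subrr; exact: T2_sub.1.
have xt : x \in t by rewrite -(perm_mem st) mem_head.
case/splitPr: xt st => p q st.
have {}IHs : T2 k X (word s - word (p ++ q)).
  by apply: IHs; rewrite -(perm_cons x) (permPl st) -cat1s perm_catCA.
rewrite word_cons !word_cat word_cons.
rewrite (_ : _ - _ = gen k x * (word s - word (p ++ q))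
   + (gen k x * word p - word p * gen k x) * word q).
  apply: (subspaceD T2_sub); first exact: (T2_tideal.2 _ _ IHs).1.
  exact: (T2_tideal.2 _ _ (T2_word_comm _ _)).2.
by rewrite word_cat; exact: swap_letter.
Qed.

(** * T-spaces over an infinite field *)

Section Maximality.
Hypothesis k_infinite : infinite_set [set: k].

(** The substitution x := a x multiplies a word by a to the power of its degree
    in x, so the components are coefficients of a polynomial in a with values
    in V. *)
Lemma tspace_component (V : set A) (V_tspace : tspace V) (x : X)
    (r : seq (seq X)) (c : seq X -> k) (d : nat) :
  V (\sum_(s <- r) c s *: word s) ->
  V (\sum_(s <- r | count_mem x s == d) c s *: word s).
Proof.
move=> Vf; pose e i : A := \sum_(s <- r | count_mem x s == i) c s *: word s.
(* the maximum with d covers degrees that do not occur in r *)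
pose n := (maxn d (\max_(s <- r) count_mem x s)).+1.
rewrite -[\sum_(s <- r | _) _]/(e d).
apply: (subspace_coef V_tspace.1 k_infinite (n := n) (e := e)) => [a|]; last first.
  by rewrite ltnS leq_maxl.
have [phi phiE] := free_alg_hom free_alg_central
  (fun y => (if y == x then a else 1) *: gen k y).
rewrite (_ : \sum_(i < n) _ = phi (\sum_(s <- r) c s *: word s)).
  exact: V_tspace.2.
rewrite raddf_sum; under eq_bigr => i _ do rewrite scaler_sumr.
rewrite (exchange_big_dep xpredT) //=; apply: eq_big_seq => s sr.
have s_lt : (count_mem x s < n)%N.
  by rewrite ltnS (leq_trans _ (leq_maxr _ _)) // leq_bigmax_seq.
rewrite linearZ /= (scaling_word _ phiE).
rewrite (big_pred1 (Ordinal s_lt)) => [|i]; last by rewrite /= -val_eqE eq_sym.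
by rewrite !scalerA mulrC.
Qed.

(** Splitting with respect to one variable keeps homogeneity in the others, so
    the variables that occur can be treated one at a time. *)
Lemma multihomogeneous_sub (V W : set A) :
    tspace V -> subspace W ->
    (forall (r : seq (seq X)) (c : seq X -> k),
       {in r &, forall s t, perm_eq s t} ->
       V (\sum_(s <- r) c s *: word s) -> W (\sum_(s <- r) c s *: word s)) ->
  V `<=` W.
Proof.
move=> V_tspace W_sub VW f; have [r [c ->]] := sum_of_words f.
(* xs lists the variables in which r may still fail to be homogeneous *)
suff graded (xs : seq X) : forall r c,
    (forall x, x \notin xs -> {in r &, forall s t, count_mem x s = count_mem x t}) ->
    V (\sum_(s <- r) c s *: word s) -> W (\sum_(s <- r) c s *: word s).
  apply: (graded (flatten r)) => x xNr s t sr tr.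
  have x0 u : u \in r -> count_mem x u = 0%N.
    by move=> ur; apply/count_memPn; apply: contra xNr => xu; apply/flattenP; exists u.
  by rewrite !x0.
elim: xs => [|x xs IHxs] {}r {}c r_hom Vr.
  by apply: VW Vr => s t sr tr; apply/allP => x _; apply/eqP; exact: r_hom.
pose n := (\max_(s <- r) count_mem x s).+1.
rewrite (_ : \sum_(s <- r) _ =
    \sum_(d < n) \sum_(s <- r | count_mem x s == d) c s *: word s).
  apply: subspace_sum => // d _; rewrite -big_filter; apply: IHxs.
    move=> y yNxs s t; rewrite !mem_filter => /andP[/eqP sd sr] /andP[/eqP td tr].
    have [->|yx] := eqVneq y x; first by rewrite sd td.
    by apply: r_hom; rewrite // inE negb_or yx.
  by rewrite big_filter; exact: tspace_component.
rewrite (exchange_big_dep xpredT) //=; apply: eq_big_seq => s sr.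
have s_lt : (count_mem x s < n)%N by rewrite ltnS leq_bigmax_seq.
by rewrite (big_pred1 (Ordinal s_lt)) => [|i]; last by rewrite /= -val_eqE eq_sym.
Qed.

(** Sending the variables other than x to 1 and x to 1 + a u leaves a polynomial
    in a, whose linear coefficient is a nonzero multiple of u. *)
Lemma tspace_full (V : set A) (V_tspace : tspace V)
    (r : seq (seq X)) (c : seq X -> k) (x : X) (d : nat) :
    {in r, forall s, count_mem x s = d} -> d%:R != 0 :> k ->
    \sum_(s <- r) c s != 0 -> V (\sum_(s <- r) c s *: word s) ->
  V = setT.
Proof.
move=> r_deg d_neq0 c_neq0 Vf; apply/seteqP; split=> // u _.
set C := \sum_(s <- r) c s in c_neq0.
have d_gt0 : (0 < d)%N by case: (d) d_neq0 => //; rewrite eqxx.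
pose e i : A := (C * 'C(d, i)%:R) *: u ^+ i.
suff : V (e 1%N).
  rewrite /e bin1 expr1 => /(subspaceZ V_tspace.1 (C * d%:R)^-1).
  by rewrite scalerA mulVf ?scale1r // mulf_neq0.
apply: (subspace_coef V_tspace.1 k_infinite (n := d.+1) (e := e)) => // a.
have [phi phiE] := free_alg_hom free_alg_central
  (fun y => if y == x then a *: u + 1 else 1).
rewrite (_ : \sum_(i < d.+1) _ = phi (\sum_(s <- r) c s *: word s)).
  exact: V_tspace.2.
have phi_word s : phi (word s) = (a *: u + 1) ^+ count_mem x s.
  rewrite hom_word; elim: s => [|y s IHs]; first by rewrite big_nil expr0.
  by rewrite big_cons IHs phiE /=; case: eqP; rewrite ?add1n ?exprS ?mul1r.
rewrite raddf_sum.
rewrite [RHS](eq_big_seq (fun s => c s *: (a *: u + 1) ^+ d)) => [|s sr];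
  last by rewrite [LHS]linearZ /= phi_word r_deg.
rewrite -scaler_suml exprD1n scaler_sumr; apply: eq_bigr => i _.
by rewrite exprZ_free_alg -scaler_nat !scalerA mulrC mulrAC -mulrA.
Qed.

End Maximality.

(** * A T-space that contains no variable *)

(** Quantifying over all morphisms makes the condition stable under
    precomposition with an endomorphism, hence a T-space. *)
Definition critical (f : A) : Prop :=
  forall psi : {lrmorphism A -> {poly k}}, (psi f)^`() = 0.

Lemma critical_tspace : tspace critical.
Proof.
split; first split.
- by move=> psi; rewrite raddf0 deriv0.
- move=> c u v Du Dv psi.
  by rewrite linearP derivD derivZ Du Dv scaler0 addr0.
move=> phi u Du psi; exact: (Du (psi \o phi)).
Qed.

(** A zero derivative need not survive multiplication, so T2 is compared first
    with the common kernel of the morphisms to k[t], which is a T-ideal and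
    contains the commutators because k[t] is commutative. *)
Lemma T2_critical : T2 k X `<=` critical.
Proof.
suff sub : T2 k X `<=`
    [set f : A | forall psi : {lrmorphism A -> {poly k}}, psi f = 0].
  by move=> f /sub f0 psi; rewrite f0 deriv0.
apply: smallest_sub => [|_ [x [y [_ ->]]] psi]; last first.
  by rewrite [LHS]raddfB /= !rmorphM /= [X in X - _]mulrC subrr.
split; first split; first split.
- by move=> psi; rewrite raddf0.
- by move=> c u v u0 v0 psi; rewrite linearP /= u0 v0 scaler0 addr0.
- by move=> phi u u0 psi; exact: (u0 (psi \o phi)).
by move=> u v v0; split=> psi; rewrite rmorphM /= v0 ?mulr0 ?mul0r.
Qed.

Lemma power_critical (x : X) :
  tspace_gen [set gen k x ^+ fchar k] `<=` critical.
Proof.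
apply: smallest_sub => [|_ -> psi]; first exact: critical_tspace.
rewrite rmorphXn /= deriv_exp -mulr_natr -polyC_natr.
have /eqP -> : (fchar k)%:R == 0 :> k by rewrite -fchar_dvd.
by rewrite mulr0.
Qed.

Lemma gen_not_critical (x : X) : ~ critical (gen k x).
Proof.
have [psi psiE] := free_alg_hom (fun c (u v : {poly k}) => esym (scalerAr c u v))
  (fun=> 'X).
by move/(_ psi); rewrite psiE derivX; apply/eqP; rewrite oner_eq0.
Qed.

End FreeAlgebra.

(** * The maximum proper T-space *)

Theorem proposition6p1 (X : choiceType) (k : fieldType)
    (k_infinite : infinite_set [set: k]) (x : X) :
  maximum_proper_tspace
    (add_set (T2 k X) (tspace_gen [set gen k x ^+ fchar k])).
Proof.
set P := tspace_gen _; set Y := add_set _ _.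
have Y_tspace : tspace Y.
  by apply: add_tspace; [exact: (T2_tideal _ _).1 | exact: tspace_gen_tspace].
split.
  split=> // YT; have [u Tu [v Pv uv]] : Y (gen k x) by rewrite YT.
  apply: (@gen_not_critical k X x). rewrite -uv.
  apply: (subspaceD (critical_tspace k X).1); first exact: T2_critical.
  exact: power_critical Pv.
move=> W [W_tspace W_proper].
apply: (multihomogeneous_sub k_infinite) => // [|r c r_hom Wf].
  exact: Y_tspace.1.
have [->|[s0 s0r]] : r = [::] \/ exists s0, s0 \in r.
  by case: (r) => [|s0 r']; [left | right; exists s0; exact: mem_head].
  by rewrite big_nil; exact: Y_tspace.1.1.
(* modulo T2, all the words of r may be replaced by s0 *)
pose C := \sum_(s <- r) c s.
have -> : \sum_(s <- r) c s *: word k s =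
    \sum_(s <- r) c s *: (word k s - word k s0) + C *: word k s0.
  by rewrite scaler_suml -big_split; apply: eq_bigr => s _ /=; rewrite -scalerDr subrK.
have Y_sub := Y_tspace.1; have T2_sub := (T2_tideal k X).1.1.
have T2Y : T2 k X `<=` Y.
  move=> u Tu; exists u => //; exists 0; rewrite ?addr0 //.
  exact: (tspace_gen_tspace _).1.1.
apply: (subspaceD Y_sub).
  apply: T2Y; apply: (subspace_sum T2_sub) => s sr; apply: (subspaceZ T2_sub).
  by apply: T2_perm; exact: r_hom.
have [->|C_neq0] := eqVneq C 0; first by rewrite scale0r; exact: Y_sub.1.
apply: (subspaceZ Y_sub).
have [[y y_deg]|no_deg] := pselect (exists y, (count_mem y s0)%:R != 0 :> k).
  case: W_proper; apply: (tspace_full k_infinite W_tspace (r := r) (c := c) (x := y)) Wf => //.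
    by move=> s sr; exact: (permP (r_hom _ _ sr s0r)).
  exact: y_deg.
have [w s0w] : exists w, perm_eq s0 (flatten (nseq (fchar k) w)).
  apply: perm_flatten_nseq => y; rewrite fchar_dvd.
  by apply: contra_notT no_deg => y_deg; exists y.
exists (word k s0 - word k (flatten (nseq (fchar k) w))).
  exact: T2_perm.
by exists (word k (flatten (nseq (fchar k) w))); [exact: word_power | exact: subrK].
Qed.
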